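(* For positive integers $m,d$ let $$s_{m,d}=\#\{(B_1,\dots,B_d): B_i\in\Lambda_m,\ \operatorname{rank}[\,B_1\ \cdots\ B_d\,]=m\},$$ and let $t_{m,d}=\binom{m+d}{d}_2$ be the number of $d$-dimensional subspaces of $\mathbb F_2^{m+d}$. For a vector space $R$ over $\mathbb F_2$ with $\dim R=m+d$ and a fixed $d$-dimensional subspace $W\subseteq R$, the number $s_{m,d}$ is the number of binary alternating algebra structures on $R$ with $\operatorname{Ann}(R)=W$, and $s_{m,d}\,t_{m,d}$ is the number of binary alternating algebra structures on $R$ with $\dim\operatorname{Ann}(R)=d$. For $3\le m+d\le 8$ and $m\geq 2$, the values are $$\begin{array}{cc|r|r} m&d&t_{m,d}&s_{m,d}\\\hline 2&1&7&1\\ 2&2&35&3\\ 4&1&31&28\\ 3&2&155&42\\ 2&3&155&7\\ 4&2&651&3360\\ 3&3&1395&462\\ 2&4&651&15\\ 6&1&127&13888\\ 5&2&2667&937440\\ 4&3&11811&254968\\ 3&4&11811&3990\\ 2&5&2667&31\\ 6&2&10795&1012435200\\ 5&3&97155&1065765120\\ 4&4&200787&16716840\\ 3&5&97155&32550\\ 2&6&10795&63 \end{array}$$ and for the remaining pairs $(m,d)\in\{(3,1),(5,1),(7,1)\}$ no such algebra exists, i.e. $s_{m,d}=0$.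
   Context: All vector spaces are over $\mathbb F_2$. $\Lambda_m$ is the space of $m\times m$ skew-symmetric matrices over $\mathbb F_2$, meaning symmetric matrices with zero diagonal. $[\,B_1\ \cdots\ B_d\,]$ is the $m\times md$ matrix obtained by horizontal concatenation. A binary alternating algebra is an $\mathbb F_2$-algebra $(R,+,\cdot)$ (bilinear product) with $x\cdot x=0$ and $x\cdot y\cdot z=0$ for all $x,y,z\in R$. Its annihilator is $\operatorname{Ann}(R)=\{a\in R: a\cdot R=0\}$. Structures on $R$ are counted as distinct products $\cdot$ on the given vector space $R$, not up to isomorphism. *)

(* Defs.v *)
From Stdlib Require Import BinNat.
From HB Require Import structures.
From mathcomp Require Import all_boot all_order all_algebra all_field.

Set Implicit Arguments.
Unset Strict Implicit.
Unset Printing Implicit Defensive.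

Import GRing.Theory.
Local Open Scope ring_scope.

(* A subspace is stored as a canonical square matrix (vs2mx), so over a finite
   field the type {vspace vT} inherits finiteness from matrices. *)
HB.instance Definition _ (K : finFieldType) (vT : vectType K) :=
  isCountable.Build {vspace vT}
    (pcan_pickleK (can_pcan (@VectorInternalTheory.vs2mxK K vT))).
HB.instance Definition _ (K : finFieldType) (vT : vectType K) :=
  isFinite.Build {vspace vT}
    (pcan_enumP (can_pcan (@VectorInternalTheory.vs2mxK K vT))).

(* Lambda_m; the diagonal condition is not implied by skewness over F_2. *)
Definition skew_mx (m : nat) : {set 'M['F_2]_m} :=
  [set B | (B^T == - B) && [forall i, B i i == 0]].

Definition s_num (m d : nat) : nat :=
  #|[set B : {ffun 'I_d -> 'M['F_2]_m} |
      [forall i, B i \in skew_mx m] & \rank (\mxrow_(i < d) B i) == m]|.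

Definition t_num (m d : nat) : nat :=
  #|[set U : {vspace 'rV['F_2]_(m + d)} | \dim U == d]|.

Definition gauss_binom (q n k : nat) : nat :=
  (\prod_(i < k) (q ^ (n - i) - 1) %/ \prod_(i < k) (q ^ i.+1 - 1))%N.

(* A bilinear product on R is a linear map R -> Hom(R, R), and distinct products
   are distinct maps; finvect_type equips a finite-dimensional space over F_2
   with its finType structure. *)
Definition bilin_prod (R : vectType 'F_2) : predArgType :=
  finvect_type 'Hom(R, 'Hom(R, R)).

Definition prodE (R : vectType 'F_2) (mu : bilin_prod R) (x y : R) : R :=
  ((mu : 'Hom(R, 'Hom(R, R))) x) y.

(* x . y . z = 0 is required for both bracketings. *)
Definition is_alt_algebra (R : vectType 'F_2) (mu : bilin_prod R) : bool :=
  [forall x : finvect_type R, prodE mu x x == 0] &&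
  [forall x : finvect_type R, forall y : finvect_type R,
     forall z : finvect_type R,
       (prodE mu (prodE mu x y) z == 0) && (prodE mu x (prodE mu y z) == 0)].

(* The elements a whose multiplication map y |-> a . y vanishes; see mem_ann. *)
Definition ann (R : vectType 'F_2) (mu : bilin_prod R) : {vspace R} :=
  lker (mu : 'Hom(R, 'Hom(R, R))).

Lemma mem_ann (R : vectType 'F_2) (mu : bilin_prod R) (a : R) :
  a \in ann mu <-> forall y, prodE mu a y = 0.
Proof.
rewrite memv_ker; split=> [/eqP a0 y | a0]; first by rewrite /prodE a0 lfunE.
by apply/eqP/lfunP => y; rewrite [LHS]a0 lfunE.
Qed.

Definition num_alt_ann_eq (R : vectType 'F_2) (W : {vspace R}) : nat :=
  #|[set mu : bilin_prod R | is_alt_algebra mu & ann mu == W]|.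

Definition num_alt_ann_dim (R : vectType 'F_2) (d : nat) : nat :=
  #|[set mu : bilin_prod R | is_alt_algebra mu & \dim (ann mu) == d]|.

(* Rows (m, d, t_{m,d}, s_{m,d}); the values are binary numbers, read in nat
   through the coercion nat_of_bin. *)
Definition table : seq (nat * nat * N * N) :=
  [:: (2, 1,      7%num,          1%num);
      (2, 2,     35%num,          3%num);
      (4, 1,     31%num,         28%num);
      (3, 2,    155%num,         42%num);
      (2, 3,    155%num,          7%num);
      (4, 2,    651%num,       3360%num);
      (3, 3,   1395%num,        462%num);
      (2, 4,    651%num,         15%num);
      (6, 1,    127%num,      13888%num);
      (5, 2,   2667%num,     937440%num);
      (4, 3,  11811%num,     254968%num);
      (3, 4,  11811%num,       3990%num);
      (2, 5,   2667%num,         31%num);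
      (6, 2,  10795%num, 1012435200%num);
      (5, 3,  97155%num, 1065765120%num);
      (4, 4, 200787%num,   16716840%num);
      (3, 5,  97155%num,      32550%num);
      (2, 6,  10795%num,         63%num)]%N.

Definition missing_pairs : seq (nat * nat) := [:: (3, 1); (5, 1); (7, 1)]%N.

(* Main.v *)
(** An alternating bilinear map R x R -> W whose radical contains K is the same
    thing as an alternating bilinear map on R / K, and after a choice of bases of
    R / K and W it is a (\dim W)-tuple of skew matrices; its radical is exactly K
    iff the concatenation of these matrices has full rank.  For R of dimension
    m + d and K = W of dimension d this counts the algebra structures with
    annihilator W, since xyz = 0 means that R . R lies in the annihilator.
    Sorting all alternating maps on F_2^n into F_2^d by their radical instead gives
      2 ^ (d * 'C(n, 2)) = \sum_j gauss_binom 2 n j * s_{n-j,d},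
    which determines the numbers s_{n,d} and is solved in binary arithmetic. *)

Require Import Defs.
From Stdlib Require Import BinNat.
From HB Require Import structures.
From mathcomp Require Import all_boot all_order all_algebra all_field zify.

Set Implicit Arguments.
Unset Strict Implicit.
Unset Printing Implicit Defensive.

Import GRing.Theory.
Local Open Scope ring_scope.

(** * Subspaces of a finite vector space *)

Lemma card_finvect_vspace (K : finFieldType) (vT : vectType K) (U : {vspace vT}) :
  #|[set v : finvect_type vT | v \in U]| = (#|K| ^ \dim U)%N.
Proof.
case: vT U => T cT U.
rewrite -(@card_vspace K (finvect_type (Vector.Pack cT)) cT U).
by apply: eq_card => v; rewrite inE.
Qed.

(** A free tuple of length [k + 1] is a free [k]-tuple in [U] together with a vector of [U] outside
    its span, and that span has [#|K| ^ k] elements. For [k > \dim U] a factor of the product is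
    0. *)
Lemma card_free_tuples (K : finFieldType) (vT : vectType K) (U : {vspace vT})
    (k : nat) :
  #|[set X : k.-tuple (finvect_type vT) |
      @free K vT X && (@span K vT X <= U)%VS]|
    = (\prod_(i < k) (#|K| ^ \dim U - #|K| ^ i))%N.
Proof.
elim: k => [|k IHk].
  rewrite big_ord0; apply/eqP/cards1P; exists [tuple].
  by apply/setP => X; rewrite !inE tuple0 nil_free span_nil sub0v eqxx.
rewrite big_ord_recr /= -IHk -sum_nat_const -sum1_card.
have cons_bij : bijective (fun p : finvect_type vT * k.-tuple (finvect_type vT) =>
    [tuple of p.1 :: p.2]).
  exists (fun X => (thead X, [tuple of behead X])) => [[v X]|X] /=.
    by congr (_, _); apply/val_inj.
  by rewrite [in RHS](tuple_eta X).
rewrite (reindex _ (onW_bij _ cons_bij)) /=.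
under eq_bigl => p do rewrite !inE /= free_cons span_cons subv_add -memvE.
have -> : (\sum_(i in [set X : k.-tuple (finvect_type vT) |
      @free K vT X && (@span K vT X <= U)%VS]) (#|K| ^ \dim U - #|K| ^ k) =
   \sum_(X : k.-tuple (finvect_type vT) | @free K vT X && (@span K vT X <= U)%VS)
    \sum_(v : finvect_type vT |
       (v \in U) && (v \notin (@span K vT X))) 1)%N.
  apply: eq_big => X; rewrite ?inE // => /andP[freeX sXU].
  have dimX : \dim (@span K vT X) = k.
    by move: freeX; rewrite /free size_tuple => /eqP.
  rewrite -[X in (_ - _ ^ X)%N]dimX -!card_finvect_vspace sum1dep_card.
  rewrite -cardsDS; last by apply/subsetP => v; rewrite !inE; apply: (subvP sXU).
  by apply: eq_card => v; rewrite !inE andbC.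
rewrite pair_big_dep /= [RHS](reindex (fun p => (p.2, p.1))) /=; last first.
  by exists (fun p => (p.2, p.1)) => -[].
apply: eq_bigl => -[v X] /=.
by rewrite -!andbA; do !bool_congr.
Qed.

(** Free [k]-tuples of the whole space are sorted by their span; the fibre over a [k]-dimensional
    subspace consists of its ordered bases. *)
Lemma card_subspaces_mul (K : finFieldType) (vT : vectType K) (k : nat) :
  (#|[set U : {vspace vT} | \dim U == k]| * \prod_(i < k) (#|K| ^ k - #|K| ^ i)
    = \prod_(i < k) (#|K| ^ \dim {:vT} - #|K| ^ i))%N.
Proof.
rewrite -card_free_tuples -[RHS]sum1dep_card.
rewrite (partition_big (fun X : k.-tuple (finvect_type vT) => @span K vT X)
  (fun U => \dim U == k)) /=; last first.
  by move=> X /andP[/eqP ->]; rewrite size_tuple.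
rewrite -sum_nat_const; apply: eq_big => [U|U]; rewrite ?inE // => /eqP dimU.
rewrite -dimU -card_free_tuples dimU sum1dep_card; apply: eq_card => X.
rewrite !inE subvf andbT; case freeX: (free _) => //=.
have spanX : \dim (@span K vT X) = k.
  by move: freeX; rewrite /free size_tuple => /eqP.
by rewrite eqEdim spanX dimU leqnn andbT.
Qed.

Lemma prod_expnB (q n k : nat) : (k <= n)%N ->
  (\prod_(i < k) (q ^ n - q ^ i)
    = \prod_(i < k) q ^ i * \prod_(i < k) (q ^ (n - i) - 1))%N.
Proof.
move=> le_kn; rewrite -big_split; apply: eq_bigr => i _ /=.
rewrite mulnBr muln1 -expnD subnKC //.
exact: ltnW (leq_trans (ltn_ord i) le_kn).
Qed.

Lemma card_subspaces (K : finFieldType) (vT : vectType K) (k : nat) :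
  (k <= \dim {:vT})%N ->
  #|[set U : {vspace vT} | \dim U == k]| = gauss_binom #|K| (\dim {:vT}) k.
Proof.
move=> le_kn; have q_gt1 := finNzRing_gt1 K.
have := card_subspaces_mul vT k; rewrite !prod_expnB // mulnCA => /eqP.
rewrite eqn_pmul2l; last by apply: prodn_gt0 => i; rewrite expn_gt0 ltnW.
(* The index is reflected by [i |-> k - 1 - i]. *)
have -> : (\prod_(i < k) (#|K| ^ (k - i) - 1) = \prod_(i < k) (#|K| ^ i.+1 - 1))%N.
  rewrite (reindex_inj rev_ord_inj); apply: eq_bigr => i _ /=.
  by rewrite subKn.
rewrite /gauss_binom => /eqP <-; rewrite mulnK //.
by apply: prodn_gt0 => i; rewrite subn_gt0 -[X in (X < _)%N](expn0 #|K|) ltn_exp2l.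
Qed.

Lemma card_subspaces_F2 (vT : vectType 'F_2) (k : nat) :
  (k <= \dim {:vT})%N ->
  #|[set U : {vspace vT} | \dim U == k]| = gauss_binom 2 (\dim {:vT}) k.
Proof. by move/card_subspaces ->; rewrite card_Fp. Qed.

Lemma dim_rowspace (F : fieldType) (n : nat) : \dim {: 'rV[F]_n} = n.
Proof. by rewrite dimvf /dim /= mul1n. Qed.

Lemma t_numE (m d : nat) : t_num m d = gauss_binom 2 (m + d) d.
Proof.
by have := @card_subspaces_F2 'rV_(m + d) d; rewrite dim_rowspace leq_addl; apply.
Qed.

(** * Tuples of skew matrices *)

Lemma card_ltn_pairs (m : nat) :
  #|[pred p : 'I_m * 'I_m | (p.1 < p.2)%N]| = 'C(m, 2).
Proof.
rewrite -bin2_sum big_mkord -sum1_card.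
rewrite -(pair_big_dep xpredT (fun i j : 'I_m => (i < j)%N)
  (fun _ _ => 1%N)) /= (exchange_big_dep xpredT) //=.
apply: eq_bigr => j _.
by rewrite -(big_ord_widen m (fun=> 1%N) (ltnW (ltn_ord j))) sum1_card card_ord.
Qed.

(** The entries above the diagonal are arbitrary and determine the matrix; [T] encodes them as
    functions supported on [D]. *)
Lemma card_skew_mx (m : nat) : #|skew_mx m| = (2 ^ 'C(m, 2))%N.
Proof.
pose D := [pred p : 'I_m * 'I_m | (p.1 < p.2)%N].
pose skew_of (f : {ffun 'I_m * 'I_m -> 'F_2}) : 'M['F_2]_m :=
  \matrix_(i, j) (f (i, j) - f (j, i)).
pose T := [set f in pffun_on (0 : 'F_2) D predT].
have supp0 f (i j : 'I_m) : f \in T -> (j <= i)%N -> f (i, j) = 0.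
  rewrite inE => /pffun_onP[/supportP suppf _] le_ji.
  by apply: suppf; rewrite inE /= -leqNgt.
have <- : skew_of @: T = skew_mx m.
  apply/setP => B; apply/imsetP/idP => [[f _ ->]|].
    rewrite inE; apply/andP; split.
      by apply/eqP/matrixP => i j; rewrite !mxE opprB.
    by apply/forallP => i; rewrite mxE subrr.
  rewrite inE => /andP[/eqP skewB /forallP diagB].
  exists [ffun p : 'I_m * 'I_m => if (p.1 < p.2)%N then B p.1 p.2 else 0].
    rewrite inE; apply/pffun_onP; split=> //.
    by apply/supportP => p; rewrite inE ffunE => /negbTE ->.
  apply/matrixP => i j; rewrite !mxE !ffunE /=.
  case: ltngtP => [_|_|/val_inj ->]; first by rewrite subr0.
    by rewrite sub0r; move/matrixP/(_ i j): skewB; rewrite !mxE => ->; rewrite opprK.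
  by rewrite subrr; apply/eqP.
rewrite card_in_imset => [|f g fT gT /matrixP eq_fg].
  by rewrite cardsE card_pffun_on card_Fp // card_ltn_pairs.
apply/ffunP => -[i j]; case: (leqP j i) => [le_ji|lt_ij].
  by rewrite !supp0.
by have := eq_fg i j; rewrite !mxE !(supp0 _ j i) ?subr0 // ltnW.
Qed.

Lemma card_skew_tuples (m d : nat) :
  #|[set B : {ffun 'I_d -> 'M['F_2]_m} | [forall i, B i \in skew_mx m]]|
    = (2 ^ (d * 'C(m, 2)))%N.
Proof.
rewrite mulnC expnM -card_skew_mx -[X in (_ ^ X)%N](card_ord d) -card_ffun_on.
by apply: eq_card => B; rewrite inE; apply/forallP/ffun_onP.
Qed.

(** * Alternating maps with prescribed radical *)

(** Makes [linfun] usable on a bare function whose linearity is a proved proposition rather than a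
    declared structure. *)
Lemma linfunE (F : fieldType) (U V : vectType F) (f : U -> V) :
  linear f -> linfun f =1 f.
Proof.
move=> lin_f.
pose g : {linear U -> V} := HB.pack f (GRing.isLinear.Build F U V _ f lin_f).
exact: (lfunE g).
Qed.

(** ['rV_m] stands in for [V / K]: [p] projects along [K] onto a complement [C] and takes
    coordinates in a basis of [C]; [s] forms the linear combination with given coordinates. *)
Lemma quotient_coords (F : fieldType) (V : vectType F) (K : {vspace V}) (m : nat) :
  \dim {:V} = (m + \dim K)%N ->
  exists (p : 'Hom(V, 'rV[F]_m)) (s : 'Hom('rV[F]_m, V)),
    cancel s p /\ lker p = K.
Proof.
move=> dimV; have dimC : \dim K^C = m by rewrite dimv_compl dimV addnK.
(* With [m] replaced by [\dim C], basis indices of [C] serve as column indices without a cast. *)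
case: m / dimC {dimV}; set C := (K^C)%VS; set e := vbasis C.
have CK0 : (C :&: K)%VS = 0%VS by rewrite capvC capv_compl.
have KC0 : (K :&: C)%VS = 0%VS by rewrite capv_compl.
have free_e : free e := basis_free (vbasisP C).
have pE : linfun (fun x => \row_i coord e i (daddv_pi C K x))
    =1 fun x => \row_i coord e i (daddv_pi C K x).
  by apply: linfunE => a x y; apply/rowP => i; rewrite !mxE !linearP.
have sE : linfun (fun u : 'rV_(\dim C) => \sum_i u 0 i *: e`_i)
    =1 fun u => \sum_i u 0 i *: e`_i.
  apply: linfunE => a u v; rewrite scaler_sumr -big_split; apply: eq_bigr => i _.
  by rewrite /= !mxE scalerDl scalerA.
exists (linfun (fun x => \row_i coord e i (daddv_pi C K x))).
exists (linfun (fun u : 'rV_(\dim C) => \sum_i u 0 i *: e`_i)); split.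
  move=> u; rewrite sE pE; apply/rowP => i; rewrite mxE daddv_pi_id ?coord_sum_free //.
  by apply: rpred_sum => j _; rewrite rpredZ // vbasis_mem // mem_nth ?size_tuple.
apply/vspaceP => x; rewrite memv_ker pE; apply/eqP/idP => [/rowP px0|xK].
  have : x \in (C + K)%VS by rewrite addvC addv_complf memvf.
  move/(daddv_pi_add CK0) <-; rewrite [X in X + _](coord_basis (vbasisP C)).
    by rewrite big1 ?add0r ?memv_pi // => i _; have := px0 i; rewrite !mxE => ->;
      rewrite scale0r.
  exact: memv_pi.
have : x \in (C + K)%VS by rewrite addvC addv_complf memvf.
move/(daddv_pi_add CK0); rewrite (daddv_pi_id KC0 xK) -[RHS]add0r => /addIr px0.
by apply/rowP => i; rewrite !mxE px0 linear0.
Qed.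

(** The codomain is kept apart from [R]: algebras use [T = R], the recursion for [s_num] uses
    [T = 'rV_d]. *)
Definition alt_into (R T : vectType 'F_2) (W : {vspace T})
    (mu : 'Hom(R, 'Hom(R, T))) : bool :=
  [forall x : finvect_type R, mu x x == 0] &&
  [forall x : finvect_type R, forall y : finvect_type R, mu x y \in W].

Lemma alt_intoP (R T : vectType 'F_2) (W : {vspace T}) (mu : 'Hom(R, 'Hom(R, T))) :
  reflect ((forall x, mu x x = 0) /\ (forall x y, mu x y \in W)) (alt_into W mu).
Proof.
apply: (iffP andP) => -[alt im]; split.
- by move=> x; apply/eqP; apply: (forallP alt).
- by move=> x y; move/forallP/(_ x)/forallP: im; apply.
- by apply/forallP => x; rewrite alt.
- by apply/forallP => x; apply/forallP => y; apply: im.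
Qed.

Lemma alternating_opp (F : fieldType) (R T : vectType F) (mu : 'Hom(R, 'Hom(R, T))) :
  (forall x, mu x x = 0) -> forall x y, mu x y = - mu y x.
Proof.
move=> alt x y; apply/eqP; rewrite -addr_eq0; have := alt (x + y).
by rewrite !linearD /= !add_lfunE !alt add0r addr0 addrC => ->.
Qed.

(** For skew [B] the cross terms cancel, so [u B u^T] is additive in [u] and only the multiples of
    the ['e_i] matter, where the diagonal entries decide. Conversely, evaluation at ['e_i + 'e_j]
    polarizes. *)
Lemma skew_mxP (m : nat) (B : 'M['F_2]_m) :
  reflect (forall u : 'rV_m, u *m B *m u^T = 0) (B \in skew_mx m).
Proof.
rewrite inE; apply: (iffP andP) => [[/eqP skewB /forallP diagB] u|altB].
  pose q (v : 'rV_m) := v *m B *m v^T.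
  have qD v w : q (v + w) = q v + q w.
    rewrite /q [(v + w)^T]linearD /= mulmxDr !mulmxDl.
    have -> : w *m B *m v^T = - (v *m B *m w^T).
      have tr11 (A : 'M['F_2]_1) : A^T = A by apply/matrixP => i j; rewrite !ord1 mxE.
      by rewrite -[LHS]tr11 !trmx_mul trmxK skewB mulmxA mulmxN mulNmx.
    by rewrite addrA subrK.
  have q0 : q 0 = 0 by rewrite /q !mul0mx.
  rewrite -/(q u) (row_sum_delta u) (big_morph q qD q0) big1 // => i _.
  rewrite /q linearZ /= -scalemxAl -scalemxAl -scalemxAr -rowE.
  suff -> : row i B *m ('e_i : 'rV_m)^T = 0 by rewrite !scaler0.
  apply/matrixP => a b; rewrite !ord1 trmx_delta -colE !mxE.
  exact/eqP.
have entryE i j : (('e_i : 'rV_m) *m B *m ('e_j : 'rV_m)^T) 0 0 = B i j.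
  by rewrite -rowE trmx_delta -colE !mxE.
have diagB i : B i i = 0 by rewrite -entryE altB mxE.
split; last by apply/forallP => i; apply/eqP.
apply/eqP/matrixP => i j; rewrite !mxE; apply/eqP; rewrite -addr_eq0 -!entryE.
have /matrixP/(_ 0 0) := altB ('e_i + 'e_j).
rewrite [(_ + _)^T]linearD /= mulmxDr !mulmxDl !altB add0r addr0 [LHS]mxE [RHS]mxE.
by move=> ->.
Qed.

(** * Forms built from tuples of matrices *)

Section TupleForm.

Variables (F : fieldType) (R T : vectType F) (m d : nat).
Variables (p : 'Hom(R, 'rV[F]_m)) (w : d.-tuple T).

(** [B i] is the Gram matrix of the [i]-th coordinate of the form with respect to [w], pulled back
    along [p]. *)
Definition tuple_form (B : {ffun 'I_d -> 'M[F]_m}) : 'Hom(R, 'Hom(R, T)) :=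
  linfun (fun x => linfun (fun y =>
    \sum_i (p x *m B i *m (p y)^T : 'M_1) 0 0 *: w`_i)).

Lemma tuple_formE B x y :
  tuple_form B x y = \sum_i (p x *m B i *m (p y)^T : 'M_1) 0 0 *: w`_i.
Proof.
have inner z : linfun (fun y => \sum_i (p z *m B i *m (p y)^T : 'M_1) 0 0 *: w`_i)
    =1 fun y => \sum_i (p z *m B i *m (p y)^T : 'M_1) 0 0 *: w`_i.
  apply: linfunE => a u v; rewrite scaler_sumr -big_split.
  apply: eq_bigr => i _ /=; rewrite linearP /= linearP /= mulmxDr -scalemxAr.
  by rewrite !mxE scalerDl scalerA.
rewrite /tuple_form linfunE ?inner // => a u v; apply/lfunP => z.
rewrite add_lfunE scale_lfunE !inner scaler_sumr -big_split.
apply: eq_bigr => i _ /=; rewrite linearP /= !mulmxDl -!scalemxAl.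
by rewrite !mxE scalerDl scalerA.
Qed.

Hypothesis free_w : free w.

Lemma coord_tuple_form B x y i :
  coord w i (tuple_form B x y) = (p x *m B i *m (p y)^T : 'M_1) 0 0.
Proof. by rewrite tuple_formE coord_sum_free. Qed.

Variable s : 'Hom('rV[F]_m, R).
Hypothesis sK : cancel s p.

Lemma tuple_form_inj : injective tuple_form.
Proof.
move=> B C eqBC; apply/ffunP => i; apply/matrixP => j k.
have := congr1 (fun f : 'Hom(R, 'Hom(R, T)) => coord w i (f (s 'e_j) (s 'e_k))) eqBC.
by rewrite /= !coord_tuple_form !sK !trmx_delta -!rowE -!colE !mxE.
Qed.

Lemma tuple_form_ker B : (lker p <= lker (tuple_form B))%VS.
Proof.
apply/subvP => x; rewrite !memv_ker => /eqP px0; apply/eqP/lfunP => y.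
by rewrite tuple_formE px0 zero_lfunE big1 // => i _; rewrite !mul0mx mxE scale0r.
Qed.

(** A vector [x] lies in the radical iff [p x] is a left null vector of the concatenation. As [p] is
    onto, the radical is [lker p] iff the rows of the concatenation are independent. *)
Lemma tuple_form_ker_eq B :
  (lker (tuple_form B) == lker p) = (\rank (\mxrow_(i < d) B i) == m).
Proof.
have kerE x : (x \in lker (tuple_form B)) = (p x *m (\mxrow_(i < d) B i) == 0).
  rewrite memv_ker mul_mxrow; apply/eqP/eqP => [fx0|px0].
    rewrite -mxrow0; apply/eq_mxrowP => i; apply/rowP => k.
    have := congr1 (fun f : 'Hom(R, T) => coord w i (f (s 'e_k))) fx0.
    rewrite /= coord_tuple_form sK trmx_delta -colE zero_lfunE linear0.
    by rewrite !mxE.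
  apply/lfunP => y; rewrite tuple_formE zero_lfunE big1 // => i _.
  by move: px0; rewrite -mxrow0 => /eq_mxrowP ->; rewrite mul0mx mxE scale0r.
rewrite -[RHS]/(row_free _); apply/eqP/idP => [kerB|freeB].
  apply: inj_row_free => v vB0; have : s v \in lker (tuple_form B).
    by rewrite kerE sK vB0.
  by rewrite kerB memv_ker sK => /eqP.
by apply/vspaceP => x; rewrite kerE mulmx_free_eq0 // memv_ker.
Qed.

(** Since [mu] factors through [p] in both arguments, it is determined by its values on the
    [s 'e_j], whose coordinates are the matrix entries. *)
Lemma tuple_form_surj (W : {vspace T}) (mu : 'Hom(R, 'Hom(R, T))) :
  basis_of W w -> (forall x, mu x x = 0) -> (forall x y, mu x y \in W) ->
  (lker p <= lker mu)%VS -> exists B, mu = tuple_form B.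
Proof.
move=> basis_w alt im ker_mu.
exists [ffun i => \matrix_(j, k) coord w i (mu (s 'e_j) (s 'e_k))].
apply/lfunP => x; apply/lfunP => y; rewrite tuple_formE.
rewrite [LHS](coord_basis basis_w) //; apply: eq_bigr => i _; congr (_ *: _).
have ker_red z : z - s (p z) \in lker mu.
  by apply: (subvP ker_mu); rewrite memv_ker linearB /= sK subrr.
have redl z t : mu z t = mu (s (p z)) t.
  by apply/eqP; rewrite -subr_eq0 -opp_lfunE -add_lfunE -linearB /=;
    move: (ker_red z); rewrite memv_ker => /eqP ->; rewrite zero_lfunE.
(* The left argument is reduced directly; the right one is swapped to the left, reduced and swapped
   back. *)
rewrite redl alternating_opp // redl -alternating_opp //.
have muE u v : mu (s u) (s v)
    = \sum_k \sum_j (u 0 j * v 0 k) *: mu (s 'e_j) (s 'e_k).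
  rewrite {1}(row_sum_delta v) !linear_sum; apply: eq_bigr => k _.
  rewrite {1}(row_sum_delta u) !linear_sum /= sum_lfunE; apply: eq_bigr => j _.
  by rewrite !linearZ /= scale_lfunE scalerA mulrC.
rewrite muE linear_sum mxE; apply: eq_bigr => k _.
rewrite linear_sum mxE mulr_suml; apply: eq_bigr => j _.
by rewrite linearZ /= ffunE !mxE mulrAC.
Qed.

End TupleForm.

Lemma alt_into_tuple_form (R T : vectType 'F_2) (m d : nat)
    (p : 'Hom(R, 'rV['F_2]_m)) (s : 'Hom('rV['F_2]_m, R)) (w : d.-tuple T)
    (W : {vspace T}) (B : {ffun 'I_d -> 'M['F_2]_m}) :
  cancel s p -> basis_of W w ->
  alt_into W (tuple_form p w B) = [forall i, B i \in skew_mx m].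
Proof.
move=> sK basis_w; have free_w := basis_free basis_w.
apply/alt_intoP/forallP => [[alt _] i|skewB]; last split=> [x|x y].
- apply/skew_mxP => u; apply/rowP => j; rewrite ord1.
    have := congr1 (coord w i) (alt (s u)).
  by rewrite coord_tuple_form // sK linear0 => ->; rewrite mxE.
- rewrite tuple_formE big1 // => i _.
  by move/skew_mxP: (skewB i) => ->; rewrite mxE scale0r.
rewrite tuple_formE; apply: rpred_sum => i _; apply: rpredZ.
by apply: (basis_mem basis_w); apply: mem_nth; rewrite size_tuple.
Qed.

(** [tuple_form] maps tuples of skew matrices bijectively onto the maps whose radical contains [K];
    the full rank condition singles out radical exactly [K]. *)
Lemma card_alt_into (R T : vectType 'F_2) (W : {vspace T}) (K : {vspace R})
    (m : nat) : \dim {:R} = (m + \dim K)%N ->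
  #|[set mu : finvect_type 'Hom(R, 'Hom(R, T)) |
      alt_into W mu & (K <= lker (mu : 'Hom(R, 'Hom(R, T))))%VS]|
    = (2 ^ (\dim W * 'C(m, 2)))%N
  /\ #|[set mu : finvect_type 'Hom(R, 'Hom(R, T)) |
      alt_into W mu & lker (mu : 'Hom(R, 'Hom(R, T))) == K]|
    = s_num m (\dim W).
Proof.
move/quotient_coords => [p [s [sK kerp]]].
have basis_w := vbasisP W; have free_w := basis_free basis_w.
pose form B : finvect_type 'Hom(R, 'Hom(R, T)) := tuple_form p (vbasis W) B.
have form_inj : injective form by apply: tuple_form_inj.
rewrite -card_skew_tuples /s_num -!(card_imset _ form_inj).
split; apply: eq_card => mu; rewrite inE; apply/andP/imsetP => [[altW kerK]|].
- have [alt im] := alt_intoP _ _ altW; rewrite -kerp in kerK.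
  have [B muB] := tuple_form_surj sK basis_w alt im kerK.
  exists B => //; rewrite inE.
  by rewrite -(alt_into_tuple_form B sK basis_w) -muB.
- case=> B; rewrite inE => skewB ->.
  by rewrite (alt_into_tuple_form B sK basis_w) -kerp tuple_form_ker.
- have [alt im] := alt_intoP _ _ altW; rewrite -kerp in kerK.
  have sub : (lker p <= lker (mu : 'Hom(R, 'Hom(R, T))))%VS by rewrite (eqP kerK).
  have [B muB] := tuple_form_surj sK basis_w alt im sub.
  exists B => //; rewrite inE.
  rewrite -(alt_into_tuple_form B sK basis_w) -muB altW.
  by rewrite -(tuple_form_ker_eq free_w sK) -muB.
case=> B; rewrite inE => /andP[skewB rankB] ->.
by rewrite (alt_into_tuple_form B sK basis_w) -kerp (tuple_form_ker_eq free_w sK).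
Qed.

(** * Annihilators and the recursion for [s_num] *)

(** Once the annihilator is [W], the identity [(x y) z = 0] says that all products [x y] lie in
    [W]. *)
Lemma num_alt_ann_eqE (R : vectType 'F_2) (W : {vspace R}) (m : nat) :
  \dim {:R} = (m + \dim W)%N -> num_alt_ann_eq W = s_num m (\dim W).
Proof.
case/(card_alt_into W) => _ <-; apply: eq_card => mu; rewrite !inE /ann.
case: eqP => [annW|_]; last by rewrite !andbF.
rewrite !andbT; apply/andP/alt_intoP => [[alt nil]|[alt im]]; split.
- by move=> x; apply/eqP; apply: (forallP alt).
- move=> x y; rewrite -annW; apply/mem_ann => z; apply/eqP.
  by move/forallP/(_ x)/forallP/(_ y)/forallP/(_ z)/andP: nil => [].
- by apply/forallP => x; apply/eqP; apply: alt.
apply/forallP => x; apply/forallP => y; apply/forallP => z.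
have mul_W a b : a \in W -> prodE mu a b = 0.
  by rewrite -annW => /mem_ann.
apply/andP; split; apply/eqP; first exact/mul_W/im.
(* Antisymmetry brings the factor [y z], which lies in [W], to the left. *)
by rewrite /prodE alternating_opp // [X in - X]mul_W ?oppr0 //; apply: im.
Qed.

Lemma num_alt_ann_dimE (R : vectType 'F_2) (m d : nat) :
  \dim {:R} = (m + d)%N -> num_alt_ann_dim R d = (s_num m d * t_num m d)%N.
Proof.
(* [t_num] refers to subspaces of ['rV_(m + d)]; the Gaussian binomial carries the count over to
   [R]. *)
move=> dimR; rewrite t_numE -dimR -card_subspaces_F2; last first.
  by rewrite dimR leq_addl.
rewrite /num_alt_ann_dim mulnC -sum_nat_const -sum1dep_card.
rewrite (partition_big (fun mu : bilin_prod R => ann mu) (fun U => \dim U == d)) /=.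
  apply: eq_big => [U|U /eqP dimU]; rewrite ?inE // sum1dep_card -dimU.
  rewrite -num_alt_ann_eqE ?dimU //; apply: eq_card => mu; rewrite !inE -andbA.
  by case: (_ =P U) => [->|_]; rewrite ?dimU ?eqxx ?andbF.
by move=> mu /andP[].
Qed.

(* Alternating forms on 'rV_n are sorted by their radical: a form whose radical
   has dimension j is a nondegenerate form on a quotient of dimension n - j. *)
Lemma s_num_rec (n d : nat) :
  (2 ^ (d * 'C(n, 2)) = \sum_(j < n.+1) gauss_binom 2 n j * s_num (n - j) d)%N.
Proof.
have dim_rV := @dim_rowspace 'F_2.
have radE := @card_alt_into 'rV['F_2]_n 'rV['F_2]_d fullv.
(* For [K = 0] the first count ranges over all alternating maps, which gives the left-hand side. *)
have /radE[] : \dim {: 'rV['F_2]_n} = (n + \dim (0%VS : {vspace 'rV['F_2]_n}))%N.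
  by rewrite dimv0 addn0 dim_rV.
rewrite dim_rV => <- _; rewrite -sum1dep_card.
pose rad (mu : finvect_type 'Hom('rV['F_2]_n, 'Hom('rV['F_2]_n, 'rV['F_2]_d))) :=
  lker (mu : 'Hom('rV['F_2]_n, 'Hom('rV['F_2]_n, 'rV['F_2]_d))).
(* Dimensions are at most [n], so [inord] does not alter them. *)
rewrite (partition_big (fun mu => inord (\dim (rad mu)) : 'I_n.+1) xpredT) //=.
apply: eq_bigr => j _; have le_jn : (j <= n)%N by rewrite -ltnS.
have dim_lt (U : {vspace 'rV['F_2]_n}) : (\dim U < n.+1)%N.
  by rewrite ltnS -[X in (_ <= X)%N]dim_rV dimvS ?subvf.
have := @card_subspaces_F2 'rV_n j; rewrite dim_rV => <- //.
rewrite -sum_nat_const (partition_big rad (fun U => \dim U == j)) /=; last first.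
  by move=> mu /andP[_ /eqP <-]; rewrite inordK.
apply: eq_big => [U|U /eqP dimU]; rewrite ?inE // sum1dep_card.
have /radE[_] : \dim {: 'rV['F_2]_n} = (n - j + \dim U)%N by rewrite dimU subnK ?dim_rV.
rewrite dim_rV => <-; apply: eq_card => mu; rewrite !inE sub0v andbT -andbA.
by case: (_ =P U) => [->|_]; rewrite ?dimU ?inord_val ?eqxx ?andbF.
Qed.

(** * Evaluation in binary arithmetic *)

Fixpoint exp2N (n : nat) : N :=
  if n is k.+1 then N.double (exp2N k) else 1%num.

Fixpoint prodN (f : nat -> N) (k : nat) : N :=
  if k is j.+1 then N.mul (prodN f j) (f j) else 1%num.

Definition gauss_binomN (n k : nat) : N :=
  N.div (prodN (fun i => N.sub (exp2N (n - i)) 1) k)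
        (prodN (fun i => N.sub (exp2N i.+1) 1) k).

Definition sumN (f : nat -> N) (s : seq nat) : N :=
  foldr (fun i => N.add (f i)) 0%num s.

(* The values s_{n,d}, s_{n-1,d}, ..., s_{0,d}, obtained by solving s_num_rec. *)
Fixpoint s_numsN (d n : nat) : seq N :=
  if n is k.+1 then
    let s := s_numsN d k in
    N.sub (exp2N (d * 'C(n, 2)))
      (sumN (fun j => N.mul (gauss_binomN n j.+1) (nth 0%num s j)) (iota 0 n)) :: s
  else [:: 1%num].

Lemma exp2NE (n : nat) : exp2N n = (2 ^ n)%N :> nat.
Proof. by elim: n => // n IHn /=; rewrite expnS; lia. Qed.

Lemma prodNE (f : nat -> N) (k : nat) : prodN f k = (\prod_(i < k) f i)%N :> nat.
Proof. by elim: k => [|k IHk]; rewrite ?big_ord0 ?big_ord_recr //= -IHk; lia. Qed.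

Lemma sumNE (f : nat -> N) (s : seq nat) : sumN f s = (\sum_(i <- s) f i)%N :> nat.
Proof. by elim: s => [|i s IHs]; rewrite ?big_nil ?big_cons //= -IHs; lia. Qed.

Lemma nat_of_divN (a b : N) : N.div a b = (a %/ b)%N :> nat.
Proof.
(* Both divisions return 0 when the divisor is 0. *)
have [->|b_neq0] := eqVneq b 0%num; first by case: a.
have := N.div_mod' a b; have := N.mod_lt a b (elimN eqP b_neq0).
move: (N.div a b) (N.modulo a b) => q r lt_rb ->.
have -> : (b * q + r)%num = (q * b + r)%N :> nat by lia.
rewrite divnMDl ?divn_small ?addn0 //; lia.
Qed.

Lemma nat_of_subN (a b : N) : N.sub a b = (a - b)%N :> nat.
Proof. lia. Qed.

Lemma nat_of_mulN (a b : N) : N.mul a b = (a * b)%N :> nat.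
Proof. lia. Qed.

Lemma gauss_binomNE (n k : nat) : gauss_binomN n k = gauss_binom 2 n k :> nat.
Proof.
rewrite nat_of_divN !prodNE; congr (_ %/ _)%N; apply: eq_bigr => i _;
  by rewrite nat_of_subN exp2NE.
Qed.

Lemma s_num0 (d : nat) : s_num 0 d = 1%N.
Proof.
have := s_num_rec 0 d; rewrite big_ord1 muln0 expn0 subn0.
by rewrite /gauss_binom !big_ord0 divnn mul1n.
Qed.

(** In [s_num_rec] the term [j = 0] is the new value with coefficient 1; the later terms involve
    values already in the list. The truncated subtraction is exact because these terms are part of
    the sum. *)
Lemma s_numsNE (d n : nat) :
  map nat_of_bin (s_numsN d n) = [seq s_num (n - j) d | j <- iota 0 n.+1].
Proof.
elim: n => [|n IHn]; first by rewrite /= s_num0.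
have -> : iota 0 n.+2 = 0%N :: map succn (iota 0 n.+1) by rewrite -(iotaDl 1).
have -> : s_numsN d n.+1 = N.sub (exp2N (d * 'C(n.+1, 2)))
    (sumN (fun j => N.mul (gauss_binomN n.+1 j.+1) (nth 0%num (s_numsN d n) j))
      (iota 0 n.+1)) :: s_numsN d n by [].
rewrite !map_cons IHn -map_comp subn0; congr (_ :: _).
have := s_num_rec n.+1 d; rewrite nat_of_subN exp2NE => ->.
rewrite big_ord_recl subn0.
have -> : gauss_binom 2 n.+1 0 = 1%N by rewrite /gauss_binom !big_ord0 divnn.
rewrite mul1n sumNE -[RHS](addnK (\sum_(i < n.+1) gauss_binom 2 n.+1 (lift ord0 i)
  * s_num (n.+1 - lift ord0 i) d))%N; congr (_ - _)%N.
rewrite -[iota 0 n.+1]/(index_iota 0 n.+1) big_mkord; apply: eq_bigr => i _.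
rewrite nat_of_mulN gauss_binomNE; congr (_ * _)%N.
rewrite -(nth_map _ 0%N) ?IHn; last first.
  by rewrite -(size_map nat_of_bin) IHn size_map size_iota.
by rewrite (nth_map 0%N) ?size_iota // nth_iota.
Qed.

Lemma s_numNE (m d : nat) : s_num m d = head 0%num (s_numsN d m).
Proof.
have := congr1 (head 0%N) (s_numsNE d m); rewrite /= subn0 => <-.
by case: (s_numsN d m).
Qed.

Lemma t_numNE (m d : nat) : t_num m d = gauss_binomN (m + d) d.
Proof. by rewrite gauss_binomNE t_numE. Qed.

(** * Counting the algebras and checking the table *)

Theorem mainTheorem1 :
  (forall m d : nat, (0 < m)%N -> (0 < d)%N ->
     t_num m d = gauss_binom 2 (m + d) d /\
     (forall R : vectType 'F_2, \dim {:R} = (m + d)%N ->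
        (forall W : {vspace R}, \dim W = d -> num_alt_ann_eq W = s_num m d) /\
        num_alt_ann_dim R d = (s_num m d * t_num m d)%N))
  /\
  (forall (m d : nat) (tv sv : N), (m, d, tv, sv) \in table ->
     t_num m d = tv /\ s_num m d = sv)
  /\
  (forall m d : nat, (2 <= m)%N -> (0 < d)%N -> (3 <= m + d <= 8)%N ->
     ((m, d) \notin [seq (r.1.1.1, r.1.1.2) | r <- table]) =
     ((m, d) \in missing_pairs))
  /\
  (forall m d : nat, (m, d) \in missing_pairs ->
     s_num m d = 0%N /\
     (forall R : vectType 'F_2, \dim {:R} = (m + d)%N ->
        ~ exists mu : bilin_prod R, is_alt_algebra mu /\ \dim (ann mu) = d)).
Proof.
split; [|split; [|split]].
- move=> m d _ _; split; first exact: t_numE.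
  move=> R dimR; split; last exact: num_alt_ann_dimE.
  by move=> W dimW; rewrite (num_alt_ann_eqE (m := m)) dimW.
- have /allP checked : all (fun r : nat * nat * N * N =>
      (gauss_binomN (r.1.1.1 + r.1.1.2) r.1.1.2 == r.1.2) &&
      (head 0%num (s_numsN r.1.1.2 r.1.1.1) == r.2)) table by vm_compute.
  move=> m d tv sv /checked /= /andP[/eqP tvE /eqP svE].
  by rewrite t_numNE s_numNE tvE svE.
- move=> m d m_ge2 d_gt0 bounds.
  (* The bound [m + d <= 8] leaves finitely many pairs, all with entries below 9. *)
  have /allP checked : all (fun m => all (fun d =>
      [&& 2 <= m, 0 < d & 3 <= m + d <= 8]%N ==>
      (((m, d) \notin [seq (r.1.1.1, r.1.1.2) | r <- table])
        == ((m, d) \in missing_pairs))) (iota 0 9)) (iota 0 9) by vm_compute.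
  have m_lt9 : m \in iota 0 9 by rewrite mem_iota; lia.
  have d_lt9 : d \in iota 0 9 by rewrite mem_iota; lia.
  have /allP/(_ d d_lt9) := checked m m_lt9.
  by rewrite m_ge2 d_gt0 bounds => /eqP.
have /allP checked : all (fun r : nat * nat =>
    head 0%num (s_numsN r.2 r.1) == 0%num) missing_pairs by vm_compute.
move=> m d /checked /= /eqP s0; have s_num_eq0 : s_num m d = 0%N.
  by rewrite s_numNE s0.
(* The number of structures has the factor [s_num m d = 0], so the set of them is empty. *)
split=> // R /num_alt_ann_dimE; rewrite s_num_eq0 mul0n => /eqP.
rewrite cards_eq0 => /eqP/setP no_alg [mu [alt_mu /eqP dim_mu]].
by have := no_alg mu; rewrite !inE alt_mu dim_mu.
Qed.
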